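(* Let $n$ and $d$ be the number of variables and the degree, and let $r$ be an integer that is at least $n$ and at most the generic rank of degree $d$ homogeneous polynomials in $n$ variables. Let $f$ be a general homogeneous polynomial of degree $d$ in $n$ variables of rank $r$. Then $f$ is non-singular.
   Context: Polynomials are nonzero, homogeneous, with complex coefficients. The rank of $f$ of degree $d$ is the smallest $r$ such that $f=l_1^d+\cdots+l_r^d$ with $l_i$ complex linear forms. The generic rank is the rank of a general polynomial in the space of degree $d$ forms in $n$ variables. For $r$ at most the generic rank, the Zariski closure (in the projective space of degree $d$ forms) of the set of rank $r$ polynomials is the $r$th secant variety of the Veronese variety of $d$th powers of linear forms, which is irreducible; ''a general polynomial of rank $r$'' means a general point of this variety, i.e. the conclusion holds for all rank $r$ polynomials in some nonempty Zariski open subset of it. A polynomial $f$ is singular if there is a point of $\mathbb{P}^{n-1}_{\mathbb{C}}$ at which all partial derivatives of $f$ vanish, and non-singular otherwise. *)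

(* Defs.v *)
From HB Require Import structures.
From mathcomp Require Import all_boot all_order all_algebra.
From mathcomp Require Import reals.
From mathcomp Require Import complex.
From mathcomp Require Import mpoly.

Set Implicit Arguments.
Unset Strict Implicit.
Unset Printing Implicit Defensive.

Import Order.TTheory GRing.Theory Num.Theory.

Local Open Scope ring_scope.

Definition is_form (K : fieldType) (n d : nat) (f : {mpoly K[n]}) : Prop :=
  f != 0 /\ f \is d.-homog.

Definition is_sum_of_powers (K : fieldType) (n d r : nat)
    (f : {mpoly K[n]}) : Prop :=
  exists l : 'I_r -> {mpoly K[n]},
    (forall i, l i \is 1.-homog) /\ f = \sum_(i < r) l i ^+ d.

Definition has_rank (K : fieldType) (n d : nat) (f : {mpoly K[n]})
    (r : nat) : Prop :=
  is_sum_of_powers d r f /\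
  forall s : nat, is_sum_of_powers d s f -> (r <= s)%N.

Definition form_monomials (n d : nat) : {set 'X_{1..n < d.+1}} :=
  [set m : 'X_{1..n < d.+1} | mdeg m == d].

Definition form_coords (K : fieldType) (n d : nat) (f : {mpoly K[n]}) :
    'I_#|form_monomials n d| -> K :=
  fun i => f@_(enum_val i).

Arguments form_coords {K n} d f _.

(* A subset of the projective space of forms of degree [d] is represented by
   the set of all nonzero forms that are representatives of its points; being
   cut out by homogeneous polynomials in the coefficients makes a closed set
   stable under nonzero scaling. *)
Definition zariski_closed (K : fieldType) (n d : nat)
    (Z : {mpoly K[n]} -> Prop) : Prop :=
  exists E : {mpoly K[#|form_monomials n d|]} -> Prop,
    (forall P, E P -> P \is homog mdeg) /\
    (forall f, Z f <-> is_form d f /\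
                       forall P, E P -> P.@[form_coords d f] = 0).

Definition zariski_closure (K : fieldType) (n d : nat)
    (A : {mpoly K[n]} -> Prop) : {mpoly K[n]} -> Prop :=
  fun f => is_form d f /\
    forall Z : {mpoly K[n]} -> Prop,
      zariski_closed d Z -> (forall g, A g -> Z g) -> Z f.

Definition zariski_open_in (K : fieldType) (n d : nat)
    (X U : {mpoly K[n]} -> Prop) : Prop :=
  exists Z : {mpoly K[n]} -> Prop,
    zariski_closed d Z /\ forall f, U f <-> X f /\ ~ Z f.

Definition holds_for_general (K : fieldType) (n d : nat)
    (X Q : {mpoly K[n]} -> Prop) : Prop :=
  exists U : {mpoly K[n]} -> Prop,
    zariski_open_in d X U /\ (exists f, U f) /\ forall f, U f -> Q f.

Definition is_generic_rank (K : fieldType) (n d g : nat) : Prop :=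
  holds_for_general d (@is_form K n d) (fun f => has_rank d f g).

(* For [r] at most the generic rank, this closure is the [r]th secant variety of
   the Veronese variety of [d]th powers of linear forms. *)
Definition secant_variety (K : fieldType) (n d r : nat) :
    {mpoly K[n]} -> Prop :=
  zariski_closure d (fun f => is_form d f /\ has_rank d f r).

Definition singular (K : fieldType) (n : nat) (f : {mpoly K[n]}) : Prop :=
  exists p : 'I_n -> K,
    (exists i, p i != 0) /\ forall i : 'I_n, (f^`M(i)).@[p] = 0.

Definition nonsingular (K : fieldType) (n : nat) (f : {mpoly K[n]}) : Prop :=
  ~ singular f.

(* Main.v *)
Require Import Defs.
From HB Require Import structures.
From mathcomp Require Import all_boot all_order all_algebra.
From mathcomp Require Import reals.
From mathcomp Require Import complex.
From mathcomp Require Import mpoly.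
From mathcomp Require Import boolp.

(** Two observations prove the theorem.

    Nonsingularity is guaranteed by the nonvanishing of one explicit polynomial
    in the coefficients of the form.  Let [e = n * (d - 1)].  Each monomial [m]
    of degree [e] has some exponent [m i >= d - 1]; choose such an index [i] for
    each [m] and consider the forms [(m / x_i^(d-1)) * df/dx_i], which have
    degree [e].  Their coefficients on the monomials of degree [e] make a square
    matrix, linear in [f], as in Macaulay's construction of the resultant of the
    partial derivatives.  A singular point [p] of [f] makes the vector of the
    [m(p)] a nonzero kernel vector, so the determinant [D] of the matrix vanishes
    at every singular form.  At the Fermat form [x_1^d + ... + x_n^d] the matrix
    is the scalar [d], so [D] is not identically zero ([exists_macaulay_det]).

    It remains to find a form of rank exactly [r] at which [D] does not vanish
    ([exists_nonsingular_rank]).  Let [P] be an equation whose nonvanishing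
    forces rank [g], the generic rank, and let [P] be nonzero at
    [l_1^d + ... + l_g^d].  Let [l'_1, ..., l'_r] be linear forms whose [d]th
    powers add up to the Fermat form, which exist as [n <= r], and let [l'_i = 0]
    for [i > r].  On the line from the tuple [l] to the tuple [l'], the values of
    [P] on the sum of all [g] powers and of [D] on the sum of the first [r]
    powers are two nonzero univariate polynomials, so that some point of the
    line is a root of neither.  At this point the first [r] powers add up to a
    form of rank exactly [r]: otherwise fewer powers would do, and adding the
    other [g - r] powers would give the full sum a rank below [g].

    The open set of the theorem is then the complement of [D = 0] in the secant
    variety. *)

Import GRing.Theory Num.Theory.

Local Open Scope ring_scope.

(** * Forms in coordinates *)

Lemma big_form_monomials {n e : nat} {V : nmodType} (F : 'X_{1..n} -> V) :
  \sum_(i < #|form_monomials n e|) F (enum_val i) =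
  \sum_(m : 'X_{1..n < e.+1} | mdeg m == e) F m.
Proof.
rewrite -(big_enum_val (fun m : 'X_{1..n < e.+1} => F m)).
by apply: eq_bigl => m; rewrite inE.
Qed.

Lemma form_expansion {K : fieldType} {n d : nat} {f : {mpoly K[n]}} :
  f \is d.-homog ->
  f = \sum_(i < #|form_monomials n d|) form_coords d f i *: 'X_[enum_val i].
Proof.
move=> hf; have le_f : (msize f <= d.+1)%N.
  rewrite msizeE big_seq; apply: (big_ind (fun k => (k <= d.+1)%N)) => //.
    by move=> x y hx hy; rewrite geq_max hx.
  by move=> m hm; rewrite (dhomog_mf hf).
rewrite (big_form_monomials (fun m => f@_m *: 'X_[m])) {1}(mpolywE le_f).
rewrite [RHS]big_mkcond /=; apply: eq_bigr => m _.
by case: eqP => // /eqP ne; rewrite (dhomog_nemf_coeff hf ne) scale0r.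
Qed.

Lemma dhomog_meval {K : fieldType} {n d : nat} {f : {mpoly K[n]}}
    (p : 'I_n -> K) :
  f \is d.-homog ->
  f.@[p] = \sum_(i < #|form_monomials n d|)
             form_coords d f i * ('X_[enum_val i]).@[p].
Proof.
move=> /form_expansion {1}->; rewrite raddf_sum.
by apply: eq_bigr => i _; rewrite /= mevalZ.
Qed.

Lemma mderiv_dhomog {K : fieldType} {n d : nat} {f : {mpoly K[n]}} (i : 'I_n) :
  f \is d.-homog -> f^`M(i) \is (d.-1).-homog.
Proof.
move=> hf; apply/dhomogP => m; rewrite mcoeff_msupp mcoeff_deriv => nz.
have: (m + U_(i))%MM \in msupp f.
  by rewrite mcoeff_msupp; apply: contraNneq nz => ->; rewrite mul0rn.
by move/(dhomog_mf hf); rewrite /= mdegD mdeg1 addn1 => <-.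
Qed.

(** The restriction of a linear functional to forms of degree [d], as a
    polynomial in the coefficients of the form. *)
Definition linear_coord_form {K : fieldType} {n : nat} (d : nat)
    (phi : {mpoly K[n]} -> K) : {mpoly K[#|form_monomials n d|]} :=
  \sum_(j < #|form_monomials n d|) phi 'X_[enum_val j] *: 'X_j.

Lemma linear_coord_form_homog {K : fieldType} {n d : nat}
    (phi : {mpoly K[n]} -> K) : linear_coord_form d phi \is 1.-homog.
Proof.
by apply: rpred_sum => j _; apply: rpredZ; rewrite dhomogX; rewrite /= mdeg1.
Qed.

Lemma meval_linear_coord_form {K : fieldType} {n d : nat}
    (phi : {linear {mpoly K[n]} -> K^o}) {f : {mpoly K[n]}} :
  f \is d.-homog -> (linear_coord_form d phi).@[form_coords d f] = phi f.
Proof.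
move=> /form_expansion {2}->; rewrite !raddf_sum.
by apply: eq_bigr => j _; rewrite /= mevalZ mevalXU linearZ mulrC.
Qed.

(** * A determinant that vanishes at all singular forms *)

(** This is [(m / x_i^(d-1)) * df/dx_i] when [d - 1 <= m i], the only case of
    interest. *)
Definition macaulay_product {K : fieldType} {n : nat} (d : nat) (i : 'I_n)
    (m : 'X_{1..n}) (f : {mpoly K[n]}) : {mpoly K[n]} :=
  'X_[m - U_(i) *+ d.-1] * f^`M(i).

(** The codomain is [K^o] so that the entry can be a linear map to a module. *)
Definition macaulay_entry {K : fieldType} {n : nat} (d : nat) (i : 'I_n)
    (m m' : 'X_{1..n}) (f : {mpoly K[n]}) : K^o :=
  (macaulay_product d i m f)@_m'.

Lemma macaulay_entry_is_linear {K : fieldType} {n : nat} (d : nat) (i : 'I_n)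
    (m m' : 'X_{1..n}) : linear (@macaulay_entry K n d i m m').
Proof.
move=> c f h; rewrite /macaulay_entry /macaulay_product.
by rewrite mderivD mderivZ mulrDr -scalerAr mcoeffD mcoeffZ.
Qed.

HB.instance Definition _ (K : fieldType) (n d : nat) (i : 'I_n)
    (m m' : 'X_{1..n}) :=
  GRing.isLinear.Build K {mpoly K[n]} K^o _ (@macaulay_entry K n d i m m')
    (macaulay_entry_is_linear d i m m').

Definition macaulay_mx {K : fieldType} {n : nat} (d e : nat)
    (s : 'I_#|form_monomials n e| -> 'I_n) (f : {mpoly K[n]}) :
    'M[K]_#|form_monomials n e| :=
  \matrix_(a, b < #|form_monomials n e|)
    macaulay_entry d (s a) (enum_val a) (enum_val b) f.

(** The polynomial [f |-> \det (macaulay_mx f)]; the map [s] chooses, for each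
    monomial of degree [e], the partial derivative used in its row. *)
Definition macaulay_det {K : fieldType} {n : nat} (d e : nat)
    (s : 'I_#|form_monomials n e| -> 'I_n) : {mpoly K[#|form_monomials n d|]} :=
  \det (\matrix_(a, b < #|form_monomials n e|) linear_coord_form d
          (@macaulay_entry K n d (s a) (enum_val a) (enum_val b))).

Lemma dhomog_prod_linear {K : fieldType} {n k : nat}
    (F : 'I_k -> {mpoly K[n]}) :
  (forall i, F i \is 1.-homog) -> \prod_(i < k) F i \is k.-homog.
Proof.
elim: k F => [|k IHk] F hF; first by rewrite big_ord0 dhomog1.
rewrite big_ord_recl; apply: (@dhomogM n K mdeg 1 _ k) => //.
by apply: IHk => i; apply: hF.
Qed.

Lemma dhomog_det {K : fieldType} {n k : nat} (A : 'M[{mpoly K[n]}]_k) :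
  (forall i j, A i j \is 1.-homog) -> \det A \is k.-homog.
Proof.
move=> hA; apply: rpred_sum => sg _; rewrite mulr_sign.
have hp (h : 'I_k -> 'I_k) : \prod_i A i (h i) \is k.-homog.
  exact: dhomog_prod_linear.
by case: ifP => _; rewrite ?rpredN; apply: hp.
Qed.

Lemma macaulay_det_homog {K : fieldType} {n d e : nat}
    (s : 'I_#|form_monomials n e| -> 'I_n) :
  @macaulay_det K n d e s \is homog mdeg.
Proof.
apply/homogP; exists #|form_monomials n e|; apply: dhomog_det => a b.
by rewrite mxE linear_coord_form_homog.
Qed.

Lemma meval_macaulay_det {K : fieldType} {n d e : nat}
    (s : 'I_#|form_monomials n e| -> 'I_n) {f : {mpoly K[n]}} :
  f \is d.-homog ->
  (macaulay_det d e s).@[form_coords d f] = \det (macaulay_mx d e s f).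
Proof.
move=> hf; rewrite /macaulay_det -det_map_mx; congr (\det _).
by apply/matrixP => a b; rewrite !mxE; apply: meval_linear_coord_form.
Qed.

Lemma macaulay_product_homog {K : fieldType} {n d e : nat} {f : {mpoly K[n]}}
    (i : 'I_n) (m : 'X_{1..n}) :
  f \is d.-homog -> mdeg m = e -> (d.-1 <= m i)%N ->
  macaulay_product d i m f \is e.-homog.
Proof.
move=> hf hm hi; have le_m : (U_(i) *+ d.-1 <= m)%MM.
  apply/mnm_lepP => j; rewrite mulmnE mnm1E.
  by case: eqP => [<-|_]; rewrite ?mul1n.
rewrite /macaulay_product -hm -{2}(submK le_m) mdegD.
rewrite mdegMn mdeg1 mul1n; apply: dhomogM; last exact: mderiv_dhomog.
by rewrite dhomogX.
Qed.

(** At a singular point [p], the values at [p] of all monomials of degree [e]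
    form a vector killed by the matrix: each row of the product is the value
    at [p] of a multiple of a partial derivative.  The vector is nonzero because
    it contains the power [p i ^ e] of a nonzero coordinate. *)
Lemma macaulay_det_nonsingular {K : fieldType} {n d e : nat}
    (s : 'I_#|form_monomials n e| -> 'I_n)
    (hs : forall a : 'I_#|form_monomials n e|,
      (d.-1 <= (enum_val a : 'X_{1..n}) (s a))%N)
    {f : {mpoly K[n]}} :
  f \is d.-homog -> (macaulay_det d e s).@[form_coords d f] != 0 ->
  nonsingular f.
Proof.
move=> hf; rewrite meval_macaulay_det // => /negP nz [p [[i pi_neq0] hp]].
apply: nz; rewrite -det_tr; apply/det0P.
exists (\row_(b < #|form_monomials n e|) ('X_[enum_val b]).@[p]).
  (* The entry of the vector at the monomial [x_i^e] is [p i ^ e]. *)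
  have hei : mdeg (U_(i) *+ e)%MM = e by rewrite mdegMn mdeg1 mul1n.
  have lt_e : (mdeg (U_(i) *+ e)%MM < e.+1)%N by rewrite hei.
  have in_e : BMultinom lt_e \in form_monomials n e by rewrite inE /= hei.
  apply/eqP => /rowP /(_ (enum_rank_in in_e (BMultinom lt_e))) /eqP.
  rewrite !mxE enum_rankK_in // -mpolyXn rmorphXn /= mevalXU expf_eq0.
  by rewrite (negPf pi_neq0) andbF.
apply/rowP => a; rewrite !mxE.
have := enum_valP a; rewrite inE => /eqP ha.
have /(dhomog_meval p) := macaulay_product_homog (s a) _ hf ha (hs a).
rewrite /macaulay_product mevalM hp mulr0 => sum0.
rewrite [RHS]sum0.
by apply: eq_bigr => b _; rewrite !mxE mulrC.
Qed.

Definition fermat {K : fieldType} (n d : nat) : {mpoly K[n]} :=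
  \sum_(i < n) 'X_i ^+ d.

(** The partial derivative of the Fermat form in [x_i] is [d * x_i^(d-1)], so
    that the row indexed by the monomial [m] has the single entry [d], on the
    diagonal. *)
Lemma macaulay_det_fermat {K : numFieldType} {n d e : nat}
    (s : 'I_#|form_monomials n e| -> 'I_n)
    (hs : forall a : 'I_#|form_monomials n e|,
      (d.-1 <= (enum_val a : 'X_{1..n}) (s a))%N) :
  (0 < d)%N -> (macaulay_det d e s).@[form_coords d (@fermat K n d)] != 0.
Proof.
move=> d_gt0; have hf : @fermat K n d \is d.-homog.
  apply: rpred_sum => i _; rewrite mpolyXn dhomogX.
  by rewrite /= mdegMn mdeg1 mul1n.
rewrite meval_macaulay_det // (_ : macaulay_mx _ _ _ _ = d%:R%:M).
  by rewrite det_scalar expf_neq0 // pnatr_eq0 -lt0n.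
apply/matrixP => a b; rewrite !mxE /macaulay_entry /macaulay_product.
have -> : (@fermat K n d)^`M(s a) = d%:R *: 'X_[U_(s a) *+ d.-1].
  rewrite /fermat raddf_sum (bigD1 (s a)) //= big1 => [|i ne].
    rewrite addr0 mpolyXn mderivX mulmnE mnm1E eqxx mul1n; congr (_ *: 'X_[_]).
    apply/mnmP => j; rewrite mnmBE !mulmnE.
    by rewrite -[d in LHS](prednK d_gt0) mulnS addKn.
  by rewrite mpolyXn mderivX mulmnE mnm1E (negPf ne) mul0n scale0r.
have le_m : (U_(s a) *+ d.-1 <= (enum_val a : 'X_{1..n}))%MM.
  apply/mnm_lepP => j; rewrite mulmnE mnm1E.
  by case: eqP => [<-|_]; rewrite ?mul1n.
rewrite -scalerAr -mpolyXD submK // mcoeffZ mcoeffX mulr_natr.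
rewrite (_ : _ == _ :> 'X_{1..n} = (a == b)) //.
by rewrite -(inj_eq enum_val_inj).
Qed.

(** Pigeonhole; it dictates the degree [n * (d - 1)] in which the determinant is
    formed. *)
Lemma exists_large_exponent {n d : nat} (m : 'X_{1..n}) :
  (0 < n)%N -> mdeg m = (n * d)%N -> exists i, (d <= m i)%N.
Proof.
move=> n_gt0 hm; apply/existsP; apply: contraT; rewrite negb_exists.
move=> /forallP small; have : (mdeg m < n * d)%N; last by rewrite hm ltnn.
rewrite mdegE -[n in (n * _)%N]card_ord -sum_nat_const.
rewrite (bigD1 (Ordinal n_gt0)) //= [X in (_ < X)%N](bigD1 (Ordinal n_gt0)) //=.
rewrite -addSn leq_add //; first by rewrite ltnNge.
by apply: leq_sum => i _; apply: ltnW; rewrite ltnNge.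
Qed.

Lemma exists_macaulay_det {K : numFieldType} {n d : nat} :
  (0 < n)%N -> (0 < d)%N ->
  exists2 D : {mpoly K[#|form_monomials n d|]}, D \is homog mdeg &
    D.@[form_coords d (fermat n d)] != 0 /\
    forall f, f \is d.-homog -> D.@[form_coords d f] != 0 -> nonsingular f.
Proof.
move=> n_gt0 d_gt0; pose e := (n * d.-1)%N.
have /fin_all_exists [s hs] : forall a : 'I_#|form_monomials n e|,
    exists i, (d.-1 <= (enum_val a : 'X_{1..n}) i)%N.
  move=> a; apply: exists_large_exponent => //.
  by have := enum_valP a; rewrite inE => /eqP.
exists (macaulay_det d e s); first exact: macaulay_det_homog.
split; first exact: macaulay_det_fermat.
by move=> f; apply: macaulay_det_nonsingular.
Qed.

(** * Polynomials along a line of sums of powers *)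

Lemma exists_nonroot {K : numFieldType} {q : {poly K}} :
  q != 0 -> exists t, q.[t] != 0.
Proof.
move=> q_neq0; apply: contrapT => no_nonroot.
pose rs : seq K := [seq i%:R | i <- iota 0 (size q)].
have rs_roots : all (root q) rs.
  by apply/allP => t _; apply: contraT => nz; case: no_nonroot; exists t.
have rs_uniq : uniq rs.
  by rewrite map_inj_uniq ?iota_uniq // => i j /eqP; rewrite eqr_nat => /eqP.
have := max_poly_roots q_neq0 rs_roots rs_uniq.
by rewrite size_map size_iota ltnn.
Qed.

(** A form with coefficients in [{poly K}] is a polynomial curve in the space of
    forms. *)
Lemma meval_curve {K : fieldType} {n d : nat}
    (P : {mpoly K[#|form_monomials n d|]}) (G : {mpoly {poly K}[n]}) :
  exists q : {poly K}, forall t,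
    q.[t] = P.@[form_coords d (map_mpoly (horner_eval t) G)].
Proof.
exists (\sum_(m <- msupp P) P@_m *: 
  \prod_(i < #|form_monomials n d|) G@_(enum_val i) ^+ m i) => t.
rewrite mevalE horner_sum; apply: eq_bigr => m _.
rewrite hornerZ horner_prod; congr (_ * _); apply: eq_bigr => i _.
by rewrite horner_exp /form_coords mcoeff_map_mpoly.
Qed.

Definition segment {K : fieldType} {n k : nat} (l0 l1 : 'I_k -> {mpoly K[n]})
    (t : K) (i : 'I_k) : {mpoly K[n]} :=
  (1 - t) *: l0 i + t *: l1 i.

Lemma meval_segment_powers {K : fieldType} {n d k : nat}
    (P : {mpoly K[#|form_monomials n d|]}) (l0 l1 : 'I_k -> {mpoly K[n]}) :
  exists q : {poly K}, forall t,
    q.[t] = P.@[form_coords d (\sum_(i < k) segment l0 l1 t i ^+ d)].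
Proof.
have [q hq] := meval_curve P (\sum_(i < k)
  ((1 - 'X) *: map_mpoly polyC (l0 i) + 'X *: map_mpoly polyC (l1 i)) ^+ d).
exists q => t; rewrite hq raddf_sum /=; congr (_.@[form_coords d _]).
have evalC (l : {mpoly K[n]}) :
    map_mpoly (horner_eval t) (map_mpoly polyC l) = l.
  by apply/mpolyP => m; rewrite !mcoeff_map_mpoly /= horner_evalE hornerC.
apply: eq_bigr => i _; rewrite rmorphXn rmorphD /=; congr (_ ^+ d).
by rewrite !map_mpolyZ !evalC /= !horner_evalE hornerD hornerN hornerC hornerX.
Qed.

Lemma segment_homog {K : fieldType} {n k e : nat} {l0 l1 : 'I_k -> {mpoly K[n]}}
    (t : K) :
  (forall i, l0 i \is e.-homog) -> (forall i, l1 i \is e.-homog) ->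
  forall i, segment l0 l1 t i \is e.-homog.
Proof. by move=> h0 h1 i; rewrite rpredD ?rpredZ. Qed.

Lemma sum_of_powers_homog {K : fieldType} {n d k : nat}
    {l : 'I_k -> {mpoly K[n]}} :
  (forall i, l i \is 1.-homog) -> \sum_(i < k) l i ^+ d \is d.-homog.
Proof.
move=> hl; apply: rpred_sum => i _.
by have := dhomogMn d (hl i); rewrite mul1n.
Qed.

(** * Consequences of the existence of a generic rank *)

Lemma is_sum_of_powersD {K : fieldType} {n d a b : nat} {f h : {mpoly K[n]}} :
  is_sum_of_powers d a f -> is_sum_of_powers d b h ->
  is_sum_of_powers d (a + b) (f + h).
Proof.
move=> [lf [hlf ->]] [lh [hlh ->]].
exists (fun i => match split i with inl j => lf j | inr j => lh j end); split.
  by move=> i; case: split.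
rewrite big_split_ord; congr (_ + _); apply: eq_bigr => i _ /=.
  by rewrite (unsplitK (inl i)).
by rewrite (unsplitK (inr i)).
Qed.

(** A form satisfying the open condition is separated from the closed set by one
    equation.  Multiplying this equation by a coordinate that is nonzero at the
    form keeps the zero polynomial out of the open set, even if the equation is
    a constant. *)
Lemma general_property_equation {K : fieldType} {n d : nat}
    {Q : {mpoly K[n]} -> Prop} :
  holds_for_general d (@is_form K n d) Q ->
  exists (f0 : {mpoly K[n]}) (P : {mpoly K[#|form_monomials n d|]}),
  [/\ is_form d f0, P.@[form_coords d f0] != 0 &
      forall f, f \is d.-homog -> P.@[form_coords d f] != 0 -> Q f].
Proof.
move=> [U [[Z [[E [_ hE]] hU]] [[f0 Uf0] UQ]]].
have [[f0_neq0 hf0] nZ] := (hU f0).1 Uf0.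
have [P EP P0] : exists2 P, E P & P.@[form_coords d f0] != 0.
  apply: contrapT => noP; apply/nZ/hE; split=> // P EP.
  by apply: contrapT => /eqP nz; apply: noP; exists P.
have [j fj] : exists j, form_coords d f0 j != 0.
  apply: contrapT => noj; case/eqP: f0_neq0; rewrite (form_expansion hf0).
  apply: big1 => j _; have -> : form_coords d f0 j = 0; last by rewrite scale0r.
  by apply: contrapT => /eqP nz; apply: noj; exists j.
exists f0, (P * 'X_j); split=> //; first by rewrite mevalM mevalXU mulf_neq0.
move=> f hf; rewrite mevalM mevalXU mulf_eq0 negb_or => /andP[Pf Xf].
apply/UQ/hU; split.
  by split=> //; apply: contraNneq Xf => ->; rewrite /form_coords mcoeff0.
by move=> /hE [_ /(_ P EP)]; apply/eqP.
Qed.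

(** In degree [0] each power is [1], so the only constant of rank [g] is [g]
    itself, whereas an open set of nonzero constants contains two different
    multiples of any of its members. *)
Lemma generic_rank_degree_gt0 {K : numFieldType} {n d g : nat} :
  is_generic_rank K n d g -> (0 < d)%N.
Proof.
move=> /general_property_equation [f0 [P [[f0_neq0 hf0] Pf0 hP]]].
rewrite lt0n; apply/negP => /eqP d0; subst d.
have rank_const (f : {mpoly K[n]}) : has_rank 0 f g -> f = g%:R.
  by move=> [[l [_ ->]] _]; rewrite big_const_ord iter_addr_0.
have [q hq] := meval_curve P ('X *: map_mpoly polyC f0).
have hqf0 t : q.[t] = P.@[form_coords 0 (t *: f0)].
  rewrite hq map_mpolyZ /= horner_evalE hornerX.
  congr (P.@[form_coords _ (_ *: _)]).
  by apply/mpolyP => m; rewrite !mcoeff_map_mpoly /= horner_evalE hornerC.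
have q_neq0 : q * ('X - 1%:P) != 0.
  rewrite mulf_neq0 ?polyXsubC_eq0 //; apply/eqP => q0.
  by move: Pf0; rewrite -[f0]scale1r -hqf0 q0 horner0 eqxx.
have [t] := exists_nonroot q_neq0.
rewrite hornerM hornerXsubC mulf_eq0 negb_or hqf0 => /andP[Pt t1].
have tf0 := rank_const _ (hP _ (rpredZ _ hf0) Pt).
have := rank_const _ (hP _ hf0 Pf0); rewrite -tf0 => /esym/eqP.
rewrite -subr_eq0 -{2}[f0]scale1r -scalerBl.
by rewrite scaler_eq0 (negPf t1) (negPf f0_neq0).
Qed.

Lemma generic_rank_nvars_gt0 {K : numFieldType} {n d g : nat} :
  is_generic_rank K n d g -> (0 < n)%N.
Proof.
move=> hg; have d_gt0 := generic_rank_degree_gt0 hg.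
have [f0 [_ [[f0_neq0 hf0] _ _]]] := general_property_equation hg.
rewrite lt0n; apply/negP => /eqP n0; subst n.
by rewrite (dhomog_uniq f0_neq0 hf0 (nvar0_homog mdeg f0)) in d_gt0.
Qed.

Lemma nonsingular_neq0 {K : fieldType} {n : nat} {f : {mpoly K[n]}} :
  (0 < n)%N -> nonsingular f -> f != 0.
Proof.
move=> n_gt0 nsing; apply/eqP => f0; apply: nsing; exists (fun=> 1); split.
  by exists (Ordinal n_gt0); apply: oner_neq0.
by move=> i; rewrite f0 mderiv0 meval0.
Qed.

Lemma fermat_sum_of_powers {K : fieldType} {n d r : nat} :
  (0 < d)%N -> (n <= r)%N -> is_sum_of_powers d r (@fermat K n d).
Proof.
move=> d_gt0 le_nr; rewrite -(subnKC le_nr) -[fermat n d]addr0.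
apply: is_sum_of_powersD.
  by exists (fun i => 'X_i); split=> // i; rewrite dhomogX /= mdeg1.
exists (fun=> 0); split=> [i|]; first exact: rpred0.
by rewrite big1 // => i _; rewrite expr0n gtn_eqF.
Qed.

(** * A form of the prescribed rank outside the determinantal hypersurface *)

(** A partial sum of [r] terms in a sum of [r + k] powers of minimal length has
    rank exactly [r].  Moving along a line towards the tuple
    that represents the Fermat form makes the partial sum avoid [D = 0] as
    well. *)
Lemma exists_nonsingular_rank {K : numFieldType} {n d r k : nat}
    (D : {mpoly K[#|form_monomials n d|]}) :
  (n <= r)%N -> is_generic_rank K n d (r + k) ->
  D.@[form_coords d (fermat n d)] != 0 ->
  exists f : {mpoly K[n]},
    [/\ f \is d.-homog, has_rank d f r & D.@[form_coords d f] != 0].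
Proof.
move=> le_nr hg D_fermat; have d_gt0 := generic_rank_degree_gt0 hg.
have [f0 [P [[_ hf0] Pf0 hP]]] := general_property_equation hg.
have [[l0 [hl0 f0E]] _] := hP f0 hf0 Pf0.
have [l1 [hl1 fermatE]] := @fermat_sum_of_powers K n d r d_gt0 le_nr.
pose l1' (i : 'I_(r + k)) := if split i is inl j then l1 j else 0.
have hl1' i : l1' i \is 1.-homog.
  by rewrite /l1'; case: split => // _; apply: rpred0.
pose head t i := segment l0 l1' t (lshift k i).
pose tail t i := segment l0 l1' t (rshift r i).
have [p hp] := meval_segment_powers P l0 l1'.
have [q hq] := meval_segment_powers D (l0 \o lshift k) (l1' \o lshift k).
have p_neq0 : p != 0.
  apply: contraNneq Pf0 => p0; rewrite f0E.
  have := hp 0; rewrite p0 horner0 => /esym/eqP.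
  congr (_.@[form_coords _ _] == _).
  by apply: eq_bigr => i _; rewrite /segment subr0 scale1r scale0r addr0.
have q_neq0 : q != 0.
  apply: contraNneq D_fermat => q0; rewrite fermatE.
  have := hq 1; rewrite q0 horner0 => /esym/eqP.
  congr (_.@[form_coords _ _] == _).
  apply: eq_bigr => i _; rewrite /segment subrr scale0r scale1r add0r /=.
  by rewrite /l1' (unsplitK (inl i)).
(* The sum of all powers has rank [r + k]; the first [r] avoid [D = 0]. *)
have [t] := exists_nonroot (mulf_neq0 p_neq0 q_neq0).
rewrite hornerM mulf_eq0 negb_or hp hq => /andP[Pt Dt].
have hseg := segment_homog t hl0 hl1'.
have [_ full_min] := hP _ (sum_of_powers_homog hseg) Pt.
exists (\sum_(i < r) head t i ^+ d); split=> //.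
  by apply: sum_of_powers_homog => i; apply: hseg.
split; first by exists (head t); split=> // i; apply: hseg.
move=> s hs; rewrite -(leq_add2r k); apply: full_min.
rewrite big_split_ord /=; apply: is_sum_of_powersD => //.
by exists (tail t); split=> // i; apply: hseg.
Qed.

Lemma general_rank_nonsingular {K : numFieldType} {n d r g : nat} :
  is_generic_rank K n d g -> (n <= r)%N -> (r <= g)%N ->
  holds_for_general d (@secant_variety K n d r)
    (fun f : {mpoly K[n]} => nonsingular f).
Proof.
move=> hg le_nr /subnKC gE; rewrite -{}gE in hg.
have d_gt0 := generic_rank_degree_gt0 hg.
have n_gt0 := generic_rank_nvars_gt0 hg.
have [D D_homog [D_fermat D_nonsing]] := @exists_macaulay_det K n d n_gt0 d_gt0.
have [f [hf rank_f Df]] := exists_nonsingular_rank D le_nr hg D_fermat.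
pose Z (h : {mpoly K[n]}) := is_form d h /\ D.@[form_coords d h] = 0.
exists (fun h => secant_variety d r h /\ ~ Z h); split.
  exists Z; split=> //; exists (eq D); split=> [_ <- //|h].
  by split=> -[form_h Dh]; split=> //; [move=> _ <- | apply: Dh].
have form_f : is_form d f.
  by split=> //; apply: (nonsingular_neq0 n_gt0); apply: D_nonsing.
split.
  exists f; split; last by move=> [_ /eqP]; apply/negP.
  by split=> // Y _; apply.
move=> h [[form_h _] nZ]; apply: D_nonsing; first exact: form_h.2.
by apply/eqP => Dh; apply: nZ.
Qed.

Theorem theorem2p3 (R : realType) (n d r g : nat)
    (hg : is_generic_rank R[i] n d g) (hnr : (n <= r)%N) (hrg : (r <= g)%N) :
  holds_for_general d (@secant_variety R[i] n d r)
    (fun f : {mpoly R[i][n]} => has_rank d f r -> nonsingular f).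
Proof.
have [U [open_U [nonempty_U U_nonsing]]] := general_rank_nonsingular hg hnr hrg.
by exists U; split=> //; split=> // f /U_nonsing.
Qed.
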